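(* Let $(W,T)$ be a dual Coxeter system of finite rank $m$ and let $W'$ be a parabolic subgroup of $W$. Then for any $w\in W'$, $$\mathrm{Red}_T(w)=\mathrm{Red}_{T'}(w),$$ where $T'=W'\cap T$ is the set of reflections in $W'$.
   Context: A dual Coxeter system of finite rank $m$ is a pair $(W,T)$, where $W$ is a group and $T\subseteq W$, such that there is a subset $S\subseteq T$ with $|S|=m$ for which $(W,S)$ is a Coxeter system and $T=\{wsw^{-1}: w\in W,\ s\in S\}$ is the set of reflections of $(W,S)$. Any such $S$ is called a simple system for $(W,T)$; different simple systems need not be conjugate in $W$. A parabolic subgroup of $W$ is a subgroup of the form $\langle s_1,\ldots,s_n\rangle$, where $\{s_1,\ldots,s_m\}$ is some simple system for $(W,T)$ (with pairwise distinct elements, listed in some order) and $n\le m$. For a subset $R\subseteq T$ and an element $w$ of the subgroup generated by $R$, $\ell_R(w)$ denotes the minimal $k$ such that $w$ is a product of $k$ elements of $R$, and $\mathrm{Red}_R(w)$ denotes the set of reduced factorizations of $w$ into elements of $R$, i.e. the set of tuples $(t_1,\ldots,t_k)\in R^k$ with $k=\ell_R(w)$ and $t_1\cdots t_k=w$. *)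

(* Defs.v *)
From HB Require Import structures.
From mathcomp Require Import all_boot.
From mathcomp Require Import boolp classical_sets functions cardinality.

Set Implicit Arguments.
Unset Strict Implicit.
Unset Printing Implicit Defensive.

Local Open Scope classical_set_scope.
Local Open Scope card_scope.
Local Open Scope group_scope.

Definition is_subgroup (W : groupType) (H : set W) : Prop :=
  H 1 /\ forall x y, H x -> H y -> H (x / y).

Definition generated_subgroup (W : groupType) (R : set W) : set W :=
  smallest (@is_subgroup W) R.

(* The entry 0 stands for infinity: the relation (s t)^0 = 1 is vacuous. *)
Definition coxeter_matrix (W : Type) (S : set W) (M : W -> W -> nat) : Prop :=
  forall s t, S s -> S t -> M s t = M t s /\ (M s t = 1%N <-> s = t).

(* The congruence on words over S generated by (s t)^(M s t) ~ [::].  Since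
   M s s = 1, it contains s s ~ [::], so every letter is its own inverse and
   the quotient of the free monoid on S is the group presented by
   < S | (s t)^(M s t) = 1 >: formal inverses of letters are not needed. *)
Inductive coxeter_cong (W : Type) (S : set W) (M : W -> W -> nat) :
    seq W -> seq W -> Prop :=
| coxeter_cong_refl u : coxeter_cong S M u u
| coxeter_cong_sym u v : coxeter_cong S M u v -> coxeter_cong S M v u
| coxeter_cong_trans u v w :
    coxeter_cong S M u v -> coxeter_cong S M v w -> coxeter_cong S M u w
| coxeter_cong_rel u v s t : S s -> S t ->
    coxeter_cong S M (u ++ flatten (nseq (M s t) [:: s; t]) ++ v) (u ++ v).

Definition coxeter_system (W : groupType) (S : set W) : Prop :=
  generated_subgroup S = setT /\
  exists2 M : W -> W -> nat, coxeter_matrix S M &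
    forall u v : seq W, [set` u] `<=` S -> [set` v] `<=` S ->
      (\prod_(x <- u) x = \prod_(x <- v) x <-> coxeter_cong S M u v).

Definition reflections (W : groupType) (S : set W) : set W :=
  [set t | exists w s, S s /\ t = w * s * w^-1].

Definition simple_system (W : groupType) (m : nat) (T S : set W) : Prop :=
  [/\ S `<=` T, S #= `I_m, coxeter_system S & T = reflections S].

Definition dual_coxeter_system (W : groupType) (m : nat) (T : set W) : Prop :=
  exists S : set W, simple_system m T S.

Definition parabolic_subgroup (W : groupType) (m : nat) (T P : set W) : Prop :=
  exists s : m.-tuple W, [/\ uniq s, simple_system m T [set` s] &
    exists2 n : nat, (n <= m)%N & P = generated_subgroup [set` take n s]].

Definition factorizations (W : groupType) (R : set W) (w : W) : set (seq W) :=
  [set u | [set` u] `<=` R /\ \prod_(t <- u) t = w].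

(* The default value 0 is used when w has no factorization, in particular when
   w is outside the subgroup generated by R. *)
Definition ell (W : groupType) (R : set W) (w : W) : nat :=
  xget 0%N [set k | (exists2 u, factorizations R w u & size u = k) /\
                    (forall u, factorizations R w u -> (k <= size u)%N)].

Definition Red (W : groupType) (R : set W) (w : W) : set (seq W) :=
  [set u | factorizations R w u /\ size u = ell R w].

(* Main.v *)
Require Import Defs.
From mathcomp Require Import all_boot.
From mathcomp Require Import boolp classical_sets.

(** Let J be a set of simple reflections generating W', and let l be the length
    with respect to the simple system S.  A factorization t_1 ... t_k of w into
    reflections is a path from 1 to w through its partial products, and each
    step strictly raises or strictly lowers l.

    If every step goes up, all the t_i lie in W'.  Indeed the last step says
    that t_k is an inversion of w, i.e. l(w t_k) < l(w).  The inversions of an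
    element can be read off any word for it as the conjugates
    s_n ... s_i ... s_n, and w has a word in J; so t_k lies in W', and one
    continues with w t_k ([inversion_generated], [ascending_generated]).

    A path starting at 1 that does not go up all the time has a peak
    x < x a > x a b.  When the factorization is reduced, a b <> 1, and
    [peak_exchange] replaces (a, b) by another pair (c, d) of its Hurwitz orbit
    such that l(x c) < l(x a).  The product, the number of factors and the
    subgroup generated by the factors do not change, while the sum of the
    lengths of the partial products drops.  By induction on this sum, every
    reduced factorization of w into reflections lies in W'
    ([reduced_factorization_generated]), and equality of the two sets of
    reduced factorizations follows.

    The exchange exists because the possible midpoints are the x c for c in the
    coset a <a b>, the set of reflections of the dihedral group <a, b>.  If all
    of them were longer than both x and x a b, neither x nor x a b would have an
    inversion in this coset, and by the cocycle rule neither would a b; but then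
    a b = 1 ([inversion_free_eq1]).

    Inversions are defined by a parity count on words.  The count does not
    change under the Coxeter relations ([reflection_parity_relation]), so it
    depends on the group element only, and it satisfies the cocycle rule
    ([inversionM]). *)

Set Implicit Arguments.
Unset Strict Implicit.
Unset Printing Implicit Defensive.

Local Open Scope classical_set_scope.
Local Open Scope group_scope.

Local Notation prodw u := (\prod_(x <- u) x).

(** * Subgroups and generation *)

Section Subgroups.

Variable W : groupType.
Implicit Types (P J : set W) (x y : W) (u v : seq W).

Lemma subgroupV P x : is_subgroup P -> P x -> P x^-1.
Proof. by move=> [P1 PV] Px; rewrite -(mul1g x^-1); apply: PV. Qed.

Lemma subgroupM P x y : is_subgroup P -> P x -> P y -> P (x * y).
Proof.
move=> sgP Px Py; rewrite -(invgK y).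
by apply: sgP.2 => //; apply: subgroupV.
Qed.

Lemma subgroup_prod P u : is_subgroup P -> [set` u] `<=` P -> P (prodw u).
Proof.
move=> sgP; elim: u => [|x u IHu] Pu; first by rewrite big_nil; apply: sgP.1.
rewrite big_cons; apply: subgroupM => //.
  by apply: Pu; rewrite /= mem_head.
by apply: IHu => y uy; apply: Pu; rewrite /= inE uy orbT.
Qed.

Lemma generated_is_subgroup J : is_subgroup (generated_subgroup J).
Proof.
split=> [K [[K1 _] _]//|x y Jx Jy K KJ]; have [[_ KV] _] := KJ.
by apply: KV; [apply: Jx | apply: Jy].
Qed.

Lemma sub_generated J : J `<=` generated_subgroup J.
Proof. by move=> x Jx K [_]; apply. Qed.

Lemma generated_factorization J x : (forall s, J s -> s * s = 1) ->
  generated_subgroup J x -> exists u, factorizations J x u.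
Proof.
move=> JJ /(_ [set y | exists u, factorizations J y u]); apply.
split; last first.
  move=> s Js; exists [:: s]; split; last by rewrite big_seq1.
  by move=> y /=; rewrite inE => /eqP->.
split=> [|y z [u [Ju <-]] [v [Jv <-]]].
  by exists [::]; split=> //; rewrite big_nil.
exists (u ++ rev v); split=> [w|].
  by rewrite /= mem_cat mem_rev => /orP[/Ju|/Jv].
rewrite big_cat /=; congr (_ * _).
elim: v Jv => [|s v IHv] Jv; first by rewrite !big_nil invg1.
rewrite rev_cons -cats1 big_cat /= big_seq1 big_cons invgM IHv.
  by rewrite (mulg1_eq (JJ s _)) //; apply: Jv; rewrite /= mem_head.
by move=> w wv; apply: Jv; rewrite /= inE wv orbT.
Qed.

End Subgroups.

(** * Reflections read off a word *)

Section WordReflections.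

Variable W : groupType.
Implicit Types (u v : seq W) (s t r x y : W).

(** For a word s_1 ... s_n of involutions with product w, the entries are the
    reflections t such that deleting one letter of the word yields w t. *)
Fixpoint subword_reflections u : seq W :=
  if u is s :: u' then s ^ prodw u' :: subword_reflections u' else [::].

Definition reflection_parity u t : bool :=
  odd (count_mem t (subword_reflections u)).

Lemma subword_reflections_cat u v :
  subword_reflections (u ++ v) =
  [seq t ^ prodw v | t <- subword_reflections u] ++ subword_reflections v.
Proof. by elim: u => //= s u ->; rewrite big_cat conjgM. Qed.

Lemma reflection_parity_cat u v t :
  reflection_parity (u ++ v) t =
  reflection_parity u (t ^ (prodw v)^-1) (+) reflection_parity v t.
Proof.
rewrite /reflection_parity subword_reflections_cat count_cat oddD count_map.
congr (odd _ (+) _); apply: eq_count => r /=.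
by rewrite -(can2_eq (conjgK _) (conjgKV _)).
Qed.

Lemma reflection_parity_split u t : reflection_parity u t ->
  exists u1 s u2, u = u1 ++ s :: u2 /\ t = s ^ prodw u2.
Proof.
have [t0|] := posnP (count_mem t (subword_reflections u)).
  by rewrite /reflection_parity t0.
rewrite -has_count has_pred1 => + _.
elim: u => //= s u IHu; rewrite inE => /predU1P[->|/IHu].
  by exists [::], s, u.
by move=> [u1 [r [u2 [-> ->]]]]; exists (s :: u1), r, u2.
Qed.

Lemma prod_alternating s t m :
  prodw (flatten (nseq m [:: s; t])) = (s * t) ^+ m.
Proof.
by elim: m => [|m IHm]; rewrite ?big_nil //= !big_cons IHm expgS mulgA.
Qed.

(** In a dihedral group, conjugating a reflection by a rotation multiplies it by
    the square of that rotation. *)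
Lemma mul_conj_involution g t n : t * t = 1 -> t * g * t = g^-1 ->
  t ^ (g ^+ n) = t * g ^+ n.*2.
Proof.
move=> tt tgt; have tgn k : g ^- k * t = t * g ^+ k.
  elim: k => [|k IHk]; first by rewrite expg0 invg1 mul1g mulg1.
  by rewrite expgSr invgM -mulgA IHk -tgt -mulgA (mulgA t t) tt mul1g -mulgA
    -expgS expgSr.
by rewrite conjgE mulgA tgn -mulgA -expgnDr addnn.
Qed.

Lemma subword_reflections_alternating s t m : s * s = 1 -> t * t = 1 ->
  subword_reflections (flatten (nseq m [:: s; t])) =
  rev [seq t * (s * t) ^+ j | j <- iota 0 m.*2].
Proof.
move=> ss tt; have tgt : t * (s * t) * t = (s * t)^-1.
  by rewrite invgM (mulg1_eq ss) (mulg1_eq tt) -!mulgA tt mulg1.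
elim: m => [//|m IHm].
rewrite doubleS -addn2 iotaD map_cat rev_cat /= IHm add0n.
rewrite big_cons prod_alternating conjgM [t ^ _]mul_conj_involution // /rev /=.
have gg : (s * t) ^ ((s * t) ^+ m) = s * t.
  by rewrite conjgE (commuteX _ (commute_refl _)) mulKg.
have -> : s ^ t = t * (s * t) by rewrite conjgE (mulg1_eq tt).
by rewrite conjMg gg mul_conj_involution // expgSr !mulgA.
Qed.

(** The 2 m reflections of the word (s t)^m are the t (s t)^j for j < 2 m; when
    (s t)^m = 1 they repeat with period m, so each occurs an even number of
    times. *)
Lemma reflection_parity_relation s t r m :
  s * s = 1 -> t * t = 1 -> (s * t) ^+ m = 1 ->
  reflection_parity (flatten (nseq m [:: s; t])) r = false.
Proof.
move=> ss tt stm; rewrite /reflection_parity.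
rewrite subword_reflections_alternating // count_rev -addnn iotaD map_cat.
rewrite add0n count_cat.
have -> : iota m m = map (addn m) (iota 0 m) by rewrite -iotaDl addn0.
rewrite -map_comp (eq_map (f := _ \o _) (g := fun j => t * (s * t) ^+ j)).
  by rewrite addnn odd_double.
by move=> j /=; rewrite expgnDr stm mul1g.
Qed.

End WordReflections.

(** * Minimal factorizations *)

Section ReflectionLength.

Variables (W : groupType) (R : set W).

Lemma ell_reduced w : (exists u, factorizations R w u) ->
  exists u, factorizations R w u /\ size u = ell R w.
Proof.
move=> [u0 Ru0]; rewrite /ell.
case: xgetP => [k _ [[u Ru uk] _]|/(_ _)]; first by exists u.
suff [k kP] : exists k, (exists2 u, factorizations R w u & size u = k) /\
    (forall u, factorizations R w u -> (k <= size u)%N) by move=> /(_ _ kP).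
have ex_size : exists k, `[< exists2 u, factorizations R w u & size u = k >].
  by exists (size u0); apply/asboolP; exists u0.
exists (ex_minn ex_size); case: ex_minnP => k /asboolP kP k_min.
split=> // u Ru.
by apply: k_min; apply/asboolP; exists u.
Qed.

Lemma ell_le w u : factorizations R w u -> (ell R w <= size u)%N.
Proof.
by move=> Ru; rewrite /ell; case: xgetP => [k _ [_ ->]|].
Qed.

End ReflectionLength.

(** * Inversions in a Coxeter system *)

Section Coxeter.

Variables (W : groupType) (S : set W).
Hypothesis S_coxeter : coxeter_system S.
Implicit Types (u v : seq W) (x y g c t : W) (C J : set W).

Local Notation T := (reflections S).

Lemma sqr_simple s : S s -> s * s = 1.
Proof.
move=> Ss; have [_ [M M_coxeter prod_cong]] := S_coxeter.
have Mss : M s s = 1%N by apply/(M_coxeter s s Ss Ss).2.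
have /prod_cong : coxeter_cong S M [:: s; s] [::].
  by have := coxeter_cong_rel M [::] [::] Ss Ss; rewrite Mss.
rewrite !big_cons big_nil mulg1; apply=> // x.
by rewrite /= !inE => /pred2P[] ->.
Qed.

(** This is where the presentation of the group enters: equal products means
    congruent words, and inserting a relator conjugates the reflections before
    it by 1 and adds each new reflection an even number of times. *)
Lemma reflection_parity_invariant u v t :
  [set` u] `<=` S -> [set` v] `<=` S -> prodw u = prodw v ->
  reflection_parity u t = reflection_parity v t.
Proof.
have [_ [M _ prod_cong]] := S_coxeter.
move=> Su Sv /(prod_cong u v Su Sv).1 uv.
suff [] : prodw u = prodw v /\ reflection_parity u =1 reflection_parity v by [].
elim: u v / uv {Su Sv} =>
  [//|u v _ [-> uv]|u v w _ [-> uv] _ [-> vw]|u v s r Ss Sr].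
- by split=> // x; rewrite uv.
- by split=> // x; rewrite uv.
have sr1 : (s * r) ^+ M s r = 1.
  have /prod_cong : coxeter_cong S M (flatten (nseq (M s r) [:: s; r])) [::].
    by have := coxeter_cong_rel M [::] [::] Ss Sr; rewrite /= cats0.
  rewrite prod_alternating big_nil; apply=> x //=.
  by elim: (M s r) => //= n IHn; rewrite !inE => /or3P[/eqP->|/eqP->|/IHn].
split=> [|x]; first by rewrite !big_cat /= prod_alternating sr1 mul1g.
rewrite !reflection_parity_cat big_cat /= prod_alternating sr1 mul1g.
by rewrite reflection_parity_relation ?sqr_simple.
Qed.

Lemma simple_factorization x : exists u, factorizations S x u.
Proof.
by apply: generated_factorization sqr_simple _; rewrite (proj1 S_coxeter).
Qed.

(** [inversion x t] means l(x t) < l(x), for a reflection t (see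
    [inversion_length] and [length_not_inversion]); counting on an arbitrary
    word for x makes the cocycle rule immediate. *)
Definition inversion x t : bool :=
  reflection_parity (xget [::] (factorizations S x)) t.

Lemma inversionE u t : [set` u] `<=` S ->
  inversion (prodw u) t = reflection_parity u t.
Proof.
move=> Su; have [] := xgetPex [::] (simple_factorization (prodw u)).
by move=> Sw w_u; apply: reflection_parity_invariant.
Qed.

Lemma inversionM x y t :
  inversion (x * y) t = inversion x (t ^ y^-1) (+) inversion y t.
Proof.
have [u [Su <-]] := simple_factorization x.
have [v [Sv <-]] := simple_factorization y.
rewrite -big_cat /= !inversionE ?reflection_parity_cat // => z /=.
by rewrite mem_cat => /orP[/Su|/Sv].
Qed.

Lemma inversion1 t : inversion 1 t = false.
Proof. by have := @inversionE [::] t; rewrite big_nil => -> // x. Qed.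

Lemma inversion_simple s t : S s -> inversion s t = (t == s).
Proof.
move=> Ss; have := @inversionE [:: s] t; rewrite big_seq1 => ->.
  by rewrite /reflection_parity /= big_nil conjg1 addn0 eq_sym; case: eqP.
by move=> x; rewrite /= inE => /eqP->.
Qed.

Lemma reflection_conj t x : T t -> T (t ^ x).
Proof.
move=> [w [s [Ss ->]]]; exists (x^-1 * w), s.
by rewrite conjgE invgM invgK !mulgA.
Qed.

Lemma reflection_involution t : T t -> t * t = 1.
Proof.
move=> [w [s [Ss ->]]].
by rewrite !mulgA mulgVK -(mulgA w) sqr_simple // mulg1 mulgV.
Qed.

(** For t = w s w^-1 the cocycle rule gives three terms.  The two coming from w
    and w^-1 are equal, as the same rule applied to w w^-1 = 1 shows; the one
    coming from s is true. *)
Lemma inversion_reflection t : T t -> inversion t t.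
Proof.
move=> [w [s [Ss ->]]].
have := inversion1 (w * s * w^-1); rewrite -(mulgV w) !inversionM.
have -> : (w * s * w^-1) ^ w^-1^-1 = s by rewrite conjgE !gnorm.
have -> : s ^ s^-1 = s by rewrite conjgE !gnorm.
rewrite (inversion_simple _ Ss) eqxx.
by do 2!case: inversion.
Qed.

Lemma inversion_mulr x t : T t -> inversion (x * t) t = ~~ inversion x t.
Proof.
move=> Tt; rewrite inversionM inversion_reflection // addbT.
by have -> : t ^ t^-1 = t by rewrite conjgE !gnorm.
Qed.

(** The strong exchange condition: t occurs among the reflections of a reduced
    word for x, and deleting the corresponding letter gives a word for x t. *)
Lemma inversion_length x t : T t -> inversion x t ->
  (ell S (x * t) < ell S x)%N.
Proof.
move=> Tt; have [u [[Su ux] uP]] := ell_reduced (simple_factorization x).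
rewrite -uP -{1}ux inversionE // => /reflection_parity_split.
move=> [u1 [s [u2 [uE tE]]]].
have Ss : S s by apply: Su; rewrite uE /= mem_cat mem_head orbT.
have : factorizations S (x * t) (u1 ++ u2).
  split=> [y|].
    rewrite /= mem_cat => /orP y12; apply: Su; rewrite uE /= mem_cat inE.
    by case: y12 => ->; rewrite ?orbT.
  rewrite -ux uE tE !big_cat big_cons /= conjgE !mulgA mulgK.
  by rewrite -(mulgA _ s s) sqr_simple // mulg1.
by move=> /ell_le/leq_ltn_trans; apply; rewrite uE !size_cat addnS.
Qed.

Lemma length_not_inversion x t : T t -> ~~ inversion x t ->
  (ell S x < ell S (x * t))%N.
Proof.
move=> Tt xt; rewrite -{1}(mulgK t x) (mulg1_eq (reflection_involution Tt)).
by apply: inversion_length; rewrite ?inversion_mulr.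
Qed.

(** The reflection g s inverts itself.  But the inversions of g s in C are those
    of s, i.e. s only, because g has none in C.  Hence g s = s. *)
Lemma inversion_free_simple C g s : C `<=` T -> S s -> C s ->
  (forall c, C c -> C (g * c)) -> (forall c d, C c -> C d -> C (c * d * c)) ->
  (forall c, C c -> inversion g c = false) -> g = 1.
Proof.
move=> CT Ss Cs gC CC g0; have Cgs := gC _ Cs.
have := inversion_reflection (CT _ Cgs); rewrite inversionM.
have -> : (g * s) ^ s^-1 = s * (g * s) * s.
  by rewrite conjgE invgK (mulg1_eq (sqr_simple Ss)) mulgA.
rewrite g0 ?inversion_simple //; last exact: CC.
by move=> /eqP gs; apply: (mulIg s); rewrite mul1g.
Qed.

(** All the hypotheses are transported by conjugation with a simple reflection
    s outside C, since s inverts nothing but s.  Conjugating an element of C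
    down to a simple reflection, one letter at a time, one reaches a conjugate
    of C that meets the simple system, where [inversion_free_simple] applies.
    The intended C is the set of reflections of a dihedral group in which g is
    a rotation. *)
Lemma inversion_free_eq1 C g : C `<=` T -> C !=set0 ->
  (forall c, C c -> C (g * c)) -> (forall c d, C c -> C d -> C (c * d * c)) ->
  (forall c, C c -> inversion g c = false) -> g = 1.
Proof.
move=> CT [c Cc]; have [w [s0 [Ss0 cE]]] := CT _ Cc.
have [u [Su uw]] := simple_factorization w.
rewrite {}cE -{w}uw in Cc.
elim: u Su C g CT Cc => [|s u IHu] Ssu C g CT.
  by rewrite big_nil mul1g invg1 mulg1; apply: inversion_free_simple.
move=> Cc gC CC g0.
have Ss : S s by apply: Ssu; rewrite /= mem_head.
have [Cs|nCs] := pselect (C s); first exact: inversion_free_simple Cs gC CC g0.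
(* g c' is an involution, so c' g^-1 = g c'. *)
have Cconjg c' : C c' -> C (c' ^ g^-1).
  move=> Cc'; have Cgc := gC _ Cc'; rewrite conjgE invgK.
  have c'K := mulg1_eq (reflection_involution (CT _ Cc')).
  have := mulg1_eq (reflection_involution (CT _ Cgc)).
  by rewrite invgM c'K => ->; apply: gC.
suff : g ^ s = 1 by move/eqP; rewrite conjg_eq1 => /eqP.
apply: (IHu _ [set d | C (d ^ s^-1)]) =>
  [x ux|d /= Cd||d /= Cd|d e /= Cd Ce|d /= Cd].
- by apply: Ssu; rewrite /= inE ux orbT.
- by rewrite -(conjgKV s d); apply/reflection_conj/CT.
- by move: Cc; rewrite /= big_cons conjgE !gnorm.
- by rewrite conjMg conjgK; apply: gC.
- by rewrite !conjMg; apply: CC.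
rewrite conjgE !inversionM g0 // (mulg1_eq (sqr_simple Ss)).
rewrite !inversion_simple //.
have /negbTE-> : d != s.
  by apply: contra_notN nCs => /eqP ds; move: Cd; rewrite ds conjgE !gnorm.
rewrite !addbF invgM conjgM.
by apply: contra_notF nCs => /eqP <-; apply: Cconjg.
Qed.

(** * Hurwitz moves at a peak *)

(** The coset a <g>.  When a and a g are reflections, it is the set of
    reflections of the dihedral group <a, a g>, and the pairs (c, c g) for c in
    it form the Hurwitz orbit of (a, a g): one move sends (c, c g) to
    (c g, c g g), and the inverse move sends it to (c / g, c). *)
Inductive reflection_coset a g : set W :=
| reflection_coset_base : reflection_coset a g a
| reflection_coset_mulr c :
    reflection_coset a g c -> reflection_coset a g (c * g)
| reflection_coset_divr c :
    reflection_coset a g c -> reflection_coset a g (c / g).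

Lemma reflection_cosetP a g c : T a -> T (a * g) -> reflection_coset a g c ->
  [/\ T c, T (c * g) & c * g * c = g^-1].
Proof.
move=> Ta Tag.
have aa := reflection_involution Ta; have agag := reflection_involution Tag.
elim=> {c} [|c _ [Tc Tcg cgc]|c _ [Tc Tcg cgc]].
- by split=> //; apply: (mulIg g); rewrite mulVg -mulgA agag.
- have cc := reflection_involution Tc.
  split=> //.
    have -> : c * g * g = c ^ g; last exact: reflection_conj.
    by rewrite conjgE -cgc -!mulgA (mulgA c c) cc mul1g.
  have cg : g * c = c / g by rewrite -cgc !mulgA cc mul1g.
  by rewrite !mulgA -(mulgA (c * g) g c) cg !mulgA mulgVK.
have cc := reflection_involution Tc.
have cg : c / g = g * c by rewrite -cgc !mulgA cc mul1g.
have gg : c / g * g = c by rewrite mulgVK.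
split; rewrite ?gg //.
  have -> : c / g = (c * g) ^ c; last exact: reflection_conj.
  by rewrite cg conjgE (mulg1_eq cc) !mulgA cc mul1g.
by rewrite mulgA cc mul1g.
Qed.

Lemma reflection_coset_commute a g c : T a -> T (a * g) ->
  reflection_coset a g c ->
  g * c = c / g /\ g^-1 * c = c * g.
Proof.
move=> Ta Tag Cc; have [Tc _ cgc] := reflection_cosetP Ta Tag Cc.
have cc := reflection_involution Tc.
by rewrite -cgc -!mulgA cc mulg1 !mulgA cc mul1g.
Qed.

Lemma reflection_coset_mull a g c : T a -> T (a * g) ->
  reflection_coset a g c -> reflection_coset a g (g * c).
Proof.
move=> Ta Tag Cc; rewrite (reflection_coset_commute Ta Tag Cc).1.
exact: reflection_coset_divr.
Qed.

Lemma reflection_coset_conj a g c d : T a -> T (a * g) ->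
  reflection_coset a g c -> reflection_coset a g d ->
  reflection_coset a g (c * d * c).
Proof.
move=> Ta Tag Cc; have comm := reflection_coset_commute Ta Tag.
have [mulC divC] := comm _ Cc.
have [mulA divA] := comm _ (reflection_coset_base a g).
elim=> {d} [|d _ Cd|d _ Cd].
- elim: Cc {mulC divC} => {c} [|c Cc IHc|c Cc IHc].
  + by rewrite (reflection_involution Ta) mul1g; apply: reflection_coset_base.
  + have [_ divC] := comm _ Cc.
    rewrite -(mulgA c g a) mulA !mulgA -(mulgA _ g^-1 c) divC mulgA.
    by do 2!apply: reflection_coset_mulr.
  have [mulC _] := comm _ Cc.
  rewrite -(mulgA c g^-1 a) divA !mulgA -(mulgA _ g c) mulC mulgA.
  by do 2!apply: reflection_coset_divr.
- by rewrite mulgA -(mulgA _ _ c) mulC mulgA; apply: reflection_coset_divr.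
by rewrite mulgA -(mulgA _ _ c) divC mulgA; apply: reflection_coset_mulr.
Qed.

(** A subgroup that contains c and c g contains g, and then with c it contains
    the whole coset c <g>, to which a and a g belong. *)
Lemma reflection_coset_generates a g c P : is_subgroup P ->
  reflection_coset a g c -> P c -> P (c * g) -> P a /\ P (a * g).
Proof.
move=> sgP Cc Pc Pcg.
have Pg : P g.
  by rewrite -(mulKg c g); apply: subgroupM => //; apply: subgroupV.
have Pa : P a.
  elim: Cc Pc {Pcg} => // e _ IHe Pe; apply: IHe.
    by rewrite -(mulgK g e); apply: sgP.2.
  by rewrite -(mulgVK g e); apply: subgroupM.
by split=> //; apply: subgroupM.
Qed.

(** Put g = a b, so that x and x g are the two feet of the peak x a.  If c in
    the coset of a is an inversion of x, then x c is below x; if c is an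
    inversion of x g, then x g c is below x g, and g c is in the coset.  Either
    way the new midpoint is below x a.  Without such c, the cocycle rule would
    leave g without inversions in the coset, so that g = 1. *)
Lemma peak_exchange x a b : T a -> T b -> a * b != 1 ->
  ~~ inversion x a -> inversion (x * a) b ->
  exists c d, [/\ T c, T d, c * d = a * b, (ell S (x * c) < ell S (x * a))%N &
    forall P, is_subgroup P -> P c -> P d -> P a /\ P b].
Proof.
move=> Ta Tb ab1 xa xab; set g := a * b in ab1 *.
have agE : a * g = b by rewrite mulgA reflection_involution // mul1g.
have Tag : T (a * g) by rewrite agE.
pose C := reflection_coset a g.
have x_xa : (ell S x < ell S (x * a))%N by apply: length_not_inversion.
have xg_xa : (ell S (x * g) < ell S (x * a))%N.
  by rewrite /g mulgA; apply: inversion_length.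
have [c Cc xc] : exists2 c, C c & (ell S (x * c) < ell S (x * a))%N.
  have CT : C `<=` T by move=> c /(reflection_cosetP Ta Tag)[].
  have [[c Cc xc]|nx] := pselect (exists2 c, C c & inversion x c).
    exists c => //; apply: ltn_trans x_xa.
    by apply: inversion_length; first exact: CT.
  have [[c Cc xgc]|nxg] := pselect (exists2 c, C c & inversion (x * g) c).
    exists (g * c); first exact: reflection_coset_mull.
    rewrite mulgA; apply: ltn_trans xg_xa.
    by apply: inversion_length; first exact: CT.
  have /negP[] := ab1; apply/eqP; apply: (inversion_free_eq1 CT).
  - by exists a; apply: reflection_coset_base.
  - by move=> c; apply: reflection_coset_mull.
  - by move=> c d; apply: reflection_coset_conj.
  move=> c Cc; apply: contra_notF nxg => gc; exists c => //.
  rewrite inversionM gc addbT; apply: contra_notN nx => xgc.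
  exists (c ^ g^-1) => //.
  have [mulC _] := reflection_coset_commute Ta Tag Cc.
  rewrite conjgE invgK -mulC; do 2!apply: reflection_coset_mull => //.
have [Tc Tcg _] := reflection_cosetP Ta Tag Cc.
exists c, (c * g); split=> //.
  by rewrite mulgA reflection_involution // mul1g.
by move=> P sgP Pc Pcg; rewrite -agE; apply: reflection_coset_generates Pc Pcg.
Qed.

(** * Paths and parabolic subgroups *)

(** Compute the inversions of x from a word in J: they are conjugates of letters
    of this word by products of letters of this word. *)
Lemma inversion_generated J x t : J `<=` S ->
  generated_subgroup J x -> inversion x t -> generated_subgroup J t.
Proof.
move=> JS Jx; have sgJ := generated_is_subgroup J.
have [|u [Ju <-]] := generated_factorization _ Jx.
  by move=> s /JS; apply: sqr_simple.
rewrite inversionE => [|y /Ju/JS//].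
move=> /reflection_parity_split[u1 [s [u2 [uE ->]]]].
have Js : generated_subgroup J s.
  by apply: sub_generated; apply: Ju; rewrite /= uE mem_cat mem_head orbT.
have Ju2 : generated_subgroup J (prodw u2).
  apply: subgroup_prod => // y u2y; apply: sub_generated; apply: Ju.
  by rewrite /= uE mem_cat inE u2y !orbT.
rewrite conjgE.
exact: (subgroupM sgJ (subgroupV sgJ Ju2) (subgroupM sgJ Js Ju2)).
Qed.

Fixpoint ascending x u : bool :=
  if u is t :: u' then ~~ inversion x t && ascending (x * t) u' else true.

Fixpoint path_length x u : nat :=
  if u is t :: u' then (ell S (x * t) + path_length (x * t) u')%N else 0%N.

Lemma path_length_cat x u v :
  path_length x (u ++ v) = (path_length x u + path_length (x * prodw u) v)%N.
Proof.
elim: u x => [|t u IHu] x /=; first by rewrite big_nil mulg1.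
by rewrite IHu big_cons mulgA addnA.
Qed.

Lemma ascending_or_peak x u :
  (if u is t :: _ then ~~ inversion x t else true) ->
  ascending x u \/
  exists u1 a b u2, [/\ u = u1 ++ [:: a, b & u2],
    ~~ inversion (x * prodw u1) a & inversion (x * prodw u1 * a) b].
Proof.
elim: u x => [|a [|b u] IHu] x xa; [by left | by left; rewrite /= xa |].
have [xab|xab] := boolP (inversion (x * a) b).
  by right; exists [::], a, b, u; rewrite big_nil mulg1.
have [asc|[u1 [c [d [u2 [-> xc xcd]]]]]] := IHu (x * a) xab.
  by left; rewrite /= xa.
by right; exists (a :: u1), c, d, u2; rewrite big_cons !mulgA.
Qed.

(** The steps are treated from the last one down: an ascending step to x t makes
    t an inversion of x t. *)
Lemma ascending_generated J x u : J `<=` S -> [set` u] `<=` T ->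
  ascending x u -> generated_subgroup J (x * prodw u) ->
  generated_subgroup J x /\ [set` u] `<=` generated_subgroup J.
Proof.
move=> JS; elim: u x => [|t u IHu] x Tu /=.
  by rewrite big_nil mulg1 => _ Jx; split.
move=> /andP[xt xtu]; rewrite big_cons mulgA => Jxu.
have Tt : T t by apply: Tu; rewrite /= mem_head.
have [Jxt Ju] : generated_subgroup J (x * t) /\
    [set` u] `<=` generated_subgroup J.
  by apply: IHu => // y uy; apply: Tu; rewrite /= inE uy orbT.
have Jt : generated_subgroup J t.
  by apply: inversion_generated Jxt _; rewrite ?inversion_mulr.
split; last by move=> y /=; rewrite inE => /predU1P[->//|/Ju].
by rewrite -(mulgK t x); apply: (generated_is_subgroup J).2.
Qed.

(** Induction on the sum of the lengths of the partial products, which a Hurwitz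
    move at a peak decreases. *)
Lemma reduced_factorization_generated J w u : J `<=` S ->
  generated_subgroup J w -> factorizations T w u -> size u = ell T w ->
  [set` u] `<=` generated_subgroup J.
Proof.
move=> JS Jw; have [n] := ubnP (path_length 1 u).
elim: n u => // n IHn u; rewrite ltnS => u_n [Tu uw] u_red.
(* The path starts at 1, which has no inversion, so its first step goes up. *)
have [||[u1 [a [b [u2 [uE xa xab]]]]]] := @ascending_or_peak 1 u.
- by case: u {u_n Tu uw u_red} => // t u; rewrite inversion1.
- move=> asc; apply: (ascending_generated JS Tu asc _).2.
  by rewrite mul1g uw.
rewrite mul1g in xa xab.
have Ta : T a by apply: Tu; rewrite uE /= mem_cat mem_head orbT.
have Tb : T b by apply: Tu; rewrite uE /= mem_cat !inE eqxx !orbT.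
have Tu1 y : y \in u1 -> T y by move=> uy; apply: Tu; rewrite uE /= mem_cat uy.
have Tu2 y : y \in u2 -> T y.
  by move=> uy; apply: Tu; rewrite uE /= mem_cat !inE uy !orbT.
(* Otherwise dropping a and b would give a shorter factorization. *)
have ab1 : a * b != 1.
  apply/eqP => ab; have /ell_le : factorizations T w (u1 ++ u2).
    split=> [y|]; first by rewrite /= mem_cat => /orP[/Tu1|/Tu2].
    by rewrite -uw uE !big_cat !big_cons /= !(mulgA a) ab mul1g.
  by rewrite -u_red uE !size_cat /= !addnS ltnNge leqW // leqnn.
have [c [d [Tc Td cdab xc genP]]] := peak_exchange Ta Tb ab1 xa xab.
pose v := u1 ++ [:: c, d & u2].
have vP : factorizations T w v.
  split=> [y|].
    by rewrite /= mem_cat !inE => /or4P[/Tu1|/eqP->|/eqP->|/Tu2].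
  by rewrite -uw uE !big_cat !big_cons /= !(mulgA c) !(mulgA a) cdab.
have Jv : [set` v] `<=` generated_subgroup J.
  apply: IHn vP _; last by rewrite -u_red uE !size_cat.
  apply: leq_trans u_n; rewrite uE !path_length_cat ltn_add2l /= mul1g.
  by rewrite -!mulgA cdab ltn_add2r.
have [Ja Jb] : generated_subgroup J a /\ generated_subgroup J b.
  by apply: genP (generated_is_subgroup _) _ _; apply: Jv;
    rewrite /= mem_cat !inE eqxx ?orbT.
move=> y; rewrite /= uE mem_cat !inE => /or4P[uy|/eqP->//|/eqP->//|uy].
  by apply: Jv; rewrite /= mem_cat uy.
by apply: Jv; rewrite /= mem_cat !inE uy !orbT.
Qed.

End Coxeter.

Theorem theorem1p4 (m : nat) (W : groupType) (T W' : set W) :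
  dual_coxeter_system m T -> parabolic_subgroup m T W' ->
  forall w : W, W' w -> Red T w = Red (W' `&` T) w.
Proof.
move=> _ [s [_ [_ _ S_coxeter TE] [n _ W'E]]] w; rewrite {}W'E {T}TE => Ww.
set S := [set` s] in S_coxeter *; set J := [set` take n s] in Ww *.
set P := generated_subgroup J in Ww *; set T := reflections S.
have JS : J `<=` S by move=> y /mem_take.
have JT : J `<=` P `&` T.
  move=> y Jy; split; first exact: sub_generated.
  by exists 1, y; rewrite mul1g invg1 mulg1; split=> //; apply: JS.
have [u [Ju uw]] : exists u, factorizations J w u.
  by apply: generated_factorization Ww => y /JS; apply: sqr_simple.
have [v [[PTv vw] v_red]] : exists v, factorizations (P `&` T) w v /\
    size v = ell (P `&` T) w.
  by apply: ell_reduced; exists u; split=> // y /Ju/JT.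
have [v' [Tv' v'_red]] : exists v, factorizations T w v /\ size v = ell T w.
  by apply: ell_reduced; exists u; split=> // y /Ju/JT[].
have red_sub z : factorizations T w z -> size z = ell T w ->
    factorizations (P `&` T) w z.
  move=> Tz z_red; split=> [y zy|]; last exact: Tz.2.
  split; last exact: Tz.1.
  exact: reduced_factorization_generated Tz z_red _ zy.
have ellE : ell T w = ell (P `&` T) w.
  apply/eqP; rewrite eqn_leq -{1}v_red -{2}v'_red !ell_le //.
    exact: red_sub.
  by split=> // y /PTv[].
apply/seteqP; split=> z [zw z_red].
  by split; [apply: red_sub | rewrite -ellE].
by split; [split=> [y /zw.1[]|]; last exact: zw.2 | rewrite ellE].
Qed.
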